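(* Suppose that $g$ is twice differentiable and that problem $(\mathrm{P})$ is strongly regular at a KKT point $\hat z^{*}\in\hat Z^{*}$. Suppose further that there is a constant $0\le\tilde\kappa<\frac1{2\gamma}$ such that $\|\nabla_x^2\mathcal{L}(\hat z^{*})-H_j\|\le\tilde\kappa$ for all $j\ge0$, and that there is a constant $0\le\omega<+\infty$ such that $\|F'(z)-F'(\hat z^{*})\|\le\omega\|z-\hat z^{*}\|$ for all $z$ in a neighborhood of $\hat z^{*}$. Then there exists a neighborhood $\mathcal{B}(\hat z^{*},r_z)$ of $\hat z^{*}$ such that the full-step SCP algorithm starting from $x^0$ with $(x^0,y^0)\in\mathcal{B}(\hat z^{*},r_z)$ generates a sequence $\{z^j\}_{j\ge0}$ satisfying $$\|z^{j+1}-\hat z^{*}\|\le(\breve\alpha+\breve c_1\|z^j-\hat z^{*}\|)\|z^j-\hat z^{*}\|,$$ where $\breve\alpha\in[0,1)$ and $\breve c_1\in[0,+\infty)$ are constants and $z^{j+1}$ is a unique KKT point of the subproblem $\mathrm{P}(x^j,H_j)$. As a consequence, the sequence $\{z^j\}$ converges linearly to $\hat z^{*}$, the unique KKT point of $(\mathrm{P})$ in $\mathcal{B}(\hat z^{*},r_z)$.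
   Context: Notation: $\|\cdot\|$ is the Euclidean norm (and the induced norm for matrices); $\mathcal{B}(x,r)$ is the open ball of radius $r$ centered at $x$; $\mathcal{S}^n_+$ is the set of real symmetric positive semidefinite $n\times n$ matrices; $g'$ is the Jacobian of $g$. Problem. Let $c\in\mathbb{R}^n$, $g:\mathbb{R}^n\to\mathbb{R}^m$ and let $\Omega\subseteq\mathbb{R}^n$ be nonempty, closed and convex. $(\mathrm{P})$ is: $\min_{x\in\mathbb{R}^n}c^Tx$ subject to $g(x)=0$, $x\in\Omega$. Let $\mathcal{N}_\Omega(x)=\{u:u^T(x-v)\ge0\ \forall v\in\Omega\}$ if $x\in\Omega$ and $\emptyset$ otherwise be the normal cone. Put $K:=\Omega\times\mathbb{R}^m$ with normal cone $\mathcal{N}_K$, $z=(x,y)\in\mathbb{R}^n\times\mathbb{R}^m$ and $$F(z):=\begin{pmatrix}c+g'(x)^Ty\\ g(x)\end{pmatrix},\qquad \nabla_x^2\mathcal{L}(z):=\sum_{i=1}^my_i\nabla^2g_i(x).$$ A KKT point of $(\mathrm{P})$ is a $z$ with $0\in F(z)+\mathcal{N}_K(z)$; $\hat Z^{*}$ is the set of KKT points. Strong regularity. $(\mathrm{P})$ is strongly regular at $\hat z^{*}\in\hat Z^{*}$ if there are balls $\mathcal{B}(0,\bar r_\delta)$ and $\mathcal{B}(\hat z^{*},\bar r_z)$ such that $\delta\mapsto\mathcal{B}(\hat z^{*},\bar r_z)\cap\{z:\delta\in F(\hat z^{*})+F'(\hat z^{*})(z-\hat z^{*})+\mathcal{N}_K(z)\}$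 is single-valued and Lipschitz continuous on $\mathcal{B}(0,\bar r_\delta)$ with Lipschitz constant $0<\gamma<+\infty$. Subproblem. For $x^j\in\Omega$ and $H_j\in\mathcal{S}^n_+$, $\mathrm{P}(x^j,H_j)$ is the convex problem: $\min_x\{c^Tx+\frac12(x-x^j)^TH_j(x-x^j)\}$ subject to $g(x^j)+g'(x^j)(x-x^j)=0$, $x\in\Omega$. Its KKT points are the $z=(x,y)$ with $0\in c+H_j(x-x^j)+g'(x^j)^Ty+\mathcal{N}_\Omega(x)$ and $g(x^j)+g'(x^j)(x-x^j)=0$. The Slater condition $\mathrm{ri}(\Omega)\cap\{x:g(x^j)+g'(x^j)(x-x^j)=0\}\neq\emptyset$ is assumed, so KKT points are exactly the pairs (solution, multiplier). Full-step SCP algorithm. Start from $x^0\in\Omega$, $y^0\in\mathbb{R}^m$ and $H_0\in\mathcal{S}^n_+$. At iteration $j=0,1,\dots$ let $z^{j+1}=(x^{j+1},y^{j+1})$ be the solution and corresponding multiplier of $\mathrm{P}(x^j,H_j)$ (full step), and choose $H_{j+1}\in\mathcal{S}^n_+$. (The stopping test is ignored, so that an infinite sequence is generated.) *)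

(* Defs.v *)
From HB Require Import structures.
From mathcomp Require Import all_boot all_order all_algebra.
From mathcomp Require Import all_classical all_reals all_analysis.

Set Implicit Arguments.
Unset Strict Implicit.
Unset Printing Implicit Defensive.

Import Order.TTheory GRing.Theory Num.Theory.
Import numFieldNormedType.Exports.

Local Open Scope classical_set_scope.
Local Open Scope ring_scope.

(* Vectors are ROW vectors and linear maps act by right multiplication, so
   that 'J g x : 'M_(n, m) is the transpose of the usual Jacobian g'(x):
   g'(x) d is written d *m 'J g x, and g'(x)^T y is written y *m ('J g x)^T.
   A pair z = (x, y) is the row vector row_mx x y : 'rV_(n + m), with
   x = lsubmx z and y = rsubmx z. *)

Section Euclidean.
Variable R : realType.

Definition dot n (u v : 'rV[R]_n) : R := (u *m v^T) 0 0.

(* The norm `|u| that MathComp-Analysis puts on matrices is the max norm, so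
   the Euclidean norm has to be introduced separately (it induces the same
   topology and the same differentials). *)
Definition enorm n (u : 'rV[R]_n) : R := Num.sqrt (dot u u).

(* Acting on rows gives the induced norm of A^T, which is that of A. *)
Definition opnorm p q (A : 'M[R]_(p, q)) : R :=
  sup [set enorm (u *m A) | u in [set u : 'rV[R]_p | enorm u <= 1]].

Definition eball n (a : 'rV[R]_n) (r : R) : set 'rV[R]_n :=
  [set u | enorm (u - a) < r].

Definition psd n (H : 'M[R]_n) : Prop :=
  H^T = H /\ forall u : 'rV[R]_n, 0 <= dot (u *m H) u.

Definition affine_hull n (A : set 'rV[R]_n) : set 'rV[R]_n :=
  [set x | exists (k : nat) (v : 'I_k -> 'rV[R]_n) (t : 'I_k -> R),
     [/\ forall i, A (v i), \sum_i t i = 1 & x = \sum_i t i *: v i]].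

Definition relative_interior n (A : set 'rV[R]_n) : set 'rV[R]_n :=
  [set x | A x /\ exists2 e, 0 < e & affine_hull A `&` eball x e `<=` A].

Definition normal_cone n (A : set 'rV[R]_n) (x : 'rV[R]_n) : set 'rV[R]_n :=
  [set u | A x /\ forall v, A v -> 0 <= dot u (x - v)].

Definition converges_linearly n (z : nat -> 'rV[R]_n) (zs : 'rV[R]_n) : Prop :=
  z @ \oo --> zs /\
  exists2 rho, 0 <= rho < 1 &
    forall j, enorm (z j.+1 - zs) <= rho * enorm (z j - zs).

End Euclidean.

Section SCP.
Variables (R : realType) (n m : nat).
Variables (c : 'rV[R]_n) (g : 'rV[R]_n -> 'rV[R]_m) (Omega : set 'rV[R]_n).

Definition twice_differentiable : Prop :=
  (forall x, differentiable g x) /\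
  (forall x, differentiable (fun x' => 'J g x') x).

(* Column i of 'J g x holds the partial derivatives of the component g_i. *)
Definition gradient (i : 'I_m) (x : 'rV[R]_n) : 'rV[R]_n := (col i ('J g x))^T.

Definition hessian (i : 'I_m) (x : 'rV[R]_n) : 'M[R]_n := 'J (gradient i) x.

Definition hessian_lagrangian (z : 'rV[R]_(n + m)) : 'M[R]_n :=
  \sum_(i < m) rsubmx z 0 i *: hessian i (lsubmx z).

Definition Fmap (z : 'rV[R]_(n + m)) : 'rV[R]_(n + m) :=
  row_mx (c + rsubmx z *m ('J g (lsubmx z))^T) (g (lsubmx z)).

Definition Kset : set 'rV[R]_(n + m) := [set z | Omega (lsubmx z)].

Definition is_KKT (z : 'rV[R]_(n + m)) : Prop :=
  [set Fmap z + u | u in normal_cone Kset z] 0.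

Definition linearized_GE (zs delta : 'rV[R]_(n + m)) : set 'rV[R]_(n + m) :=
  [set z | [set Fmap zs + (z - zs) *m 'J Fmap zs + u
           | u in normal_cone Kset z] delta].

Definition strongly_regular (zs : 'rV[R]_(n + m)) (gamma : R) : Prop :=
  0 < gamma /\
  exists rdelta rz : R, exists s : 'rV[R]_(n + m) -> 'rV[R]_(n + m),
    [/\ 0 < rdelta, 0 < rz,
        forall delta, eball 0 rdelta delta ->
          eball zs rz `&` linearized_GE zs delta = [set s delta]
      & forall delta delta', eball 0 rdelta delta -> eball 0 rdelta delta' ->
          enorm (s delta - s delta') <= gamma * enorm (delta - delta')].

Definition sub_objective (xj : 'rV[R]_n) (H : 'M[R]_n) (x : 'rV[R]_n) : R :=
  dot c x + 2^-1 * dot ((x - xj) *m H) (x - xj).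

Definition linearized_zero (xj : 'rV[R]_n) : set 'rV[R]_n :=
  [set x | g xj + (x - xj) *m 'J g xj = 0].

Definition slater (xj : 'rV[R]_n) : Prop :=
  relative_interior Omega `&` linearized_zero xj !=set0.

Definition sub_solution (xj : 'rV[R]_n) (H : 'M[R]_n) (x : 'rV[R]_n) : Prop :=
  (Omega `&` linearized_zero xj) x /\
  forall x', (Omega `&` linearized_zero xj) x' ->
    sub_objective xj H x <= sub_objective xj H x'.

Definition sub_KKT (xj : 'rV[R]_n) (H : 'M[R]_n) : set 'rV[R]_(n + m) :=
  [set z | [set c + (lsubmx z - xj) *m H + rsubmx z *m ('J g xj)^T + u
           | u in normal_cone Omega (lsubmx z)] 0 /\
           linearized_zero xj (lsubmx z)].

Definition scp_step (z : 'rV[R]_(n + m)) (H : 'M[R]_n) (z' : 'rV[R]_(n + m)) :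
    Prop :=
  sub_solution (lsubmx z) H (lsubmx z') /\ sub_KKT (lsubmx z) H z'.

Definition scp_run (H : nat -> 'M[R]_n) (z0 : 'rV[R]_(n + m))
    (z : nat -> 'rV[R]_(n + m)) : Prop :=
  z 0%N = z0 /\ forall j, scp_step (z j) (H j) (z j.+1).

(* The Slater condition holds for every subproblem that the algorithm reaches
   from z0 with the matrices H, i.e. at the end of every finite run; it must
   not presuppose that an infinite run exists. *)
Definition slater_along (H : nat -> 'M[R]_n) (z0 : 'rV[R]_(n + m)) : Prop :=
  forall (N : nat) (z : nat -> 'rV[R]_(n + m)), z 0%N = z0 ->
    (forall j, (j < N)%N -> scp_step (z j) (H j) (z j.+1)) ->
    slater (lsubmx (z N)).

End SCP.

(* Main.v *)
(* Writing the subproblem at z^j as the generalized equation linearized at zs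
   with a right-hand side delta(z), its KKT points near zs are the fixed points
   of s o delta, where s is the gamma-Lipschitz solution map given by strong
   regularity.  The map delta is affine; its linear part is F'(zs) minus the
   matrix M_j obtained from F'(z^j) by putting H_j in the Hessian block, and has
   norm at most kappa + 2 omega e with e = |z^j - zs|.  By the mean value theorem
   |delta(zs)| is at most (kappa + 3 omega e) e.  So s o delta is a contraction
   whose fixed point z satisfies, with a = gamma kappa < 1/2 and
   b = 3 gamma omega e, |z - zs| <= (a + b) / (1 - a - b) * e, which is at most
   (a / (1 - a) + 4 b) e.  As H_j is positive semidefinite, the KKT points of
   the subproblem form a convex set, so local uniqueness implies global
   uniqueness. *)

Require Import Defs.
From HB Require Import structures.
From mathcomp Require Import all_boot all_order all_algebra.
From mathcomp Require Import all_classical all_reals all_analysis.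
From mathcomp Require Import ring lra.

Set Implicit Arguments.
Unset Strict Implicit.
Unset Printing Implicit Defensive.

Import Order.TTheory GRing.Theory Num.Theory.
Import numFieldNormedType.Exports.

Local Open Scope classical_set_scope.
Local Open Scope ring_scope.

(** * Euclidean norm and operator norm *)

Section EuclideanTheory.
Variables (R : realType) (n : nat).
Implicit Types (u v w : 'rV[R]_n) (k : R).

Lemma dotE u v : dot u v = \sum_i u 0 i * v 0 i.
Proof. by rewrite /dot mxE; apply: eq_bigr => i _; rewrite mxE. Qed.

Lemma dotC u v : dot u v = dot v u.
Proof. by rewrite !dotE; apply: eq_bigr => i _; rewrite mulrC. Qed.

Lemma dotDl u v w : dot (u + v) w = dot u w + dot v w.
Proof. by rewrite /dot mulmxDl mxE. Qed.

Lemma dotNl u w : dot (- u) w = - dot u w.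
Proof. by rewrite /dot mulNmx mxE. Qed.

Lemma dotBl u v w : dot (u - v) w = dot u w - dot v w.
Proof. by rewrite dotDl dotNl. Qed.

Lemma dotZl k u w : dot (k *: u) w = k * dot u w.
Proof. by rewrite /dot -scalemxAl mxE. Qed.

Lemma dotDr w u v : dot w (u + v) = dot w u + dot w v.
Proof. by rewrite dotC dotDl !(dotC _ w). Qed.

Lemma dotNr w u : dot w (- u) = - dot w u.
Proof. by rewrite dotC dotNl dotC. Qed.

Lemma dotBr w u v : dot w (u - v) = dot w u - dot w v.
Proof. by rewrite dotDr dotNr. Qed.

Lemma dotZr k w u : dot w (k *: u) = k * dot w u.
Proof. by rewrite dotC dotZl dotC. Qed.

Lemma dot0l u : dot 0 u = 0.
Proof. by rewrite /dot mul0mx mxE. Qed.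

Lemma dot0r u : dot u 0 = 0.
Proof. by rewrite dotC dot0l. Qed.

Lemma dot_ge0 u : 0 <= dot u u.
Proof. by rewrite dotE sumr_ge0 // => i _; rewrite -expr2 sqr_ge0. Qed.

Lemma dot_eq0 u : (dot u u == 0) = (u == 0).
Proof.
apply/eqP/eqP => [|->]; last exact: dot0l.
rewrite dotE => /eqP; rewrite psumr_eq0 => [/allP u0|i _]; last first.
  by rewrite -expr2 sqr_ge0.
apply/rowP => i; rewrite mxE; apply/eqP.
by have := u0 i (mem_index_enum i); rewrite /= mulf_eq0 orbb.
Qed.

Lemma enorm_ge0 u : 0 <= enorm u. Proof. exact: sqrtr_ge0. Qed.

Lemma enorm_sqr u : enorm u ^+ 2 = dot u u.
Proof. by rewrite sqr_sqrtr ?dot_ge0. Qed.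

Lemma enorm_eq0 u : (enorm u == 0) = (u == 0).
Proof. by rewrite -(@sqrf_eq0 _ (enorm u)) enorm_sqr dot_eq0. Qed.

Lemma enorm0 : enorm (0 : 'rV[R]_n) = 0.
Proof. by apply/eqP; rewrite enorm_eq0. Qed.

Lemma enormN u : enorm (- u) = enorm u.
Proof. by rewrite /enorm dotNl dotNr opprK. Qed.

Lemma enorm_distC u v : enorm (u - v) = enorm (v - u).
Proof. by rewrite -enormN opprB. Qed.

Lemma enormZ k u : enorm (k *: u) = `|k| * enorm u.
Proof.
by rewrite /enorm dotZl dotZr mulrA -expr2 sqrtrM ?sqr_ge0 // sqrtr_sqr.
Qed.

Lemma dot_le u v : dot u v <= enorm u * enorm v.
Proof.
have [->|v0] := eqVneq v 0; first by rewrite dot0r enorm0 mulr0.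
have vv0 : 0 < dot v v by rewrite lt_def dot_eq0 v0 dot_ge0.
rewrite (le_trans (ler_norm _)) // -ler_sqr ?nnegrE ?normr_ge0 ?mulr_ge0 ?enorm_ge0 //.
rewrite exprMn !enorm_sqr real_normK ?num_real //.
(* Cauchy-Schwarz: this square equals |v|^2 (|u|^2 |v|^2 - <u, v>^2), and |v|^2 > 0. *)
have := dot_ge0 (dot v v *: u - dot u v *: v).
rewrite dotBl !dotBr !dotZl !dotZr (dotC v u) => h.
rewrite -subr_ge0 -(pmulr_rge0 _ vv0).
by apply: le_trans h _; rewrite le_eqVlt; apply/orP; left; apply/eqP; ring.
Qed.

Lemma enormD u v : enorm (u + v) <= enorm u + enorm v.
Proof.
rewrite -ler_sqr ?nnegrE ?addr_ge0 ?enorm_ge0 //.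
rewrite sqrrD !enorm_sqr dotDl !dotDr (dotC v u).
by have := dot_le u v; lra.
Qed.

Lemma enormB u v : enorm (u - v) <= enorm u + enorm v.
Proof. by rewrite (le_trans (enormD _ _)) // enormN. Qed.

Lemma enorm_sum (I : finType) (f : I -> 'rV[R]_n) :
  enorm (\sum_i f i) <= \sum_i enorm (f i).
Proof.
elim/big_ind2 : _ => // [|x1 x2 y1 y2 h1 h2]; first by rewrite enorm0.
by rewrite (le_trans (enormD _ _)) // lerD.
Qed.

Lemma coord_le_enorm u i : `|u 0 i| <= enorm u.
Proof.
rewrite -ler_sqr ?nnegrE ?normr_ge0 ?enorm_ge0 // enorm_sqr real_normK ?num_real //.
rewrite dotE (bigD1 i) //= -expr2 lerDl sumr_ge0 // => j _.
by rewrite -expr2 sqr_ge0.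
Qed.

(** The topology in use comes from the max norm; this inequality carries neighbourhoods, limits and
    boundedness over to the Euclidean norm. *)
Lemma mx_norm_le_enorm u : `|u| <= enorm u.
Proof.
rewrite [leLHS]/Num.Def.normr /= mx_normrE; apply/bigmax_leP; split => [|[i j] _ /=].
  exact: enorm_ge0.
by rewrite (ord1 i) coord_le_enorm.
Qed.

Lemma continuous_enorm : continuous (@enorm R n).
Proof.
move=> u; rewrite /enorm; apply: (@continuous_comp _ _ _ (fun x => dot x x)).
  rewrite (_ : (fun x => dot x x) = fun x => \sum_i x 0 i * x 0 i); last first.
    by apply/funext => x; rewrite dotE.
  apply: continuous_big => [|i _ x]; first exact: add_continuous.
  by apply: continuousM; exact: coord_continuous.
exact: sqrt_continuous.
Qed.

Lemma continuous_enormB (a : 'rV[R]_n) : continuous (fun u => enorm (u - a)).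
Proof.
move=> u; apply: (@continuous_comp _ _ _ (fun u => u - a) (@enorm R n)).
  by apply: continuousB; [exact: cvg_id|exact: cst_continuous].
exact: continuous_enorm.
Qed.

Lemma near_eball (a : 'rV[R]_n) (P : 'rV[R]_n -> Prop) :
  (\forall u \near a, P u) ->
  exists2 r, 0 < r & forall u, enorm (u - a) < r -> P u.
Proof.
move=> /nbhs_ballP[r /= r0 rP]; exists r => // u ur; apply: rP.
rewrite -ball_normE /= distrC; exact: le_lt_trans (mx_norm_le_enorm _) ur.
Qed.

Lemma cvg_enorm (z : nat -> 'rV[R]_n) (a : 'rV[R]_n) :
  enorm (z j - a) @[j --> \oo] --> 0 -> z @ \oo --> a.
Proof.
move=> /cvgrPdist_lt za; apply/cvgrPdist_lt => e /za; apply: filterS => j.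
rewrite sub0r normrN ger0_norm ?enorm_ge0 // distrC.
exact: le_lt_trans (mx_norm_le_enorm _).
Qed.

Definition ecball (a : 'rV[R]_n) (r : R) : set 'rV[R]_n :=
  [set u | enorm (u - a) <= r].

Lemma compact_ecball a r : compact (ecball a r).
Proof.
apply: bounded_closed_compact.
  exists (`|a| + r); split; first exact: num_real.
  move=> M hM u; rewrite /ecball /= => ur.
  rewrite -(subrK a u) (le_trans (ler_normD _ _)) //.
  have := le_trans (mx_norm_le_enorm _) ur; lra.
rewrite (_ : ecball a r = (fun u => enorm (u - a)) @^-1` [set x | x <= r]) //.
apply: preimage_closed; last exact: closed_le.
by move=> u _; exact: continuous_enormB.
Qed.

(* The displacement |T u - u| attains its minimum on the compact ball, and the
   contraction property forces this minimum to be 0. *)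
Lemma contraction_fixpoint_ecball (T : 'rV[R]_n -> 'rV[R]_n) a r q :
    0 <= r -> q < 1 -> {homo T : u / ecball a r u} ->
    {in ecball a r &, forall u v, enorm (T u - T v) <= q * enorm (u - v)} ->
  exists2 u, ecball a r u & T u = u.
Proof.
move=> r0 q1 Tball Tq.
have [//|||u uB umin] := @compact_EVT_min _ R (fun u => enorm (T u - u)) (ecball a r).
- by exists a; rewrite /ecball /= subrr enorm0.
- exact: compact_ecball.
- apply/subspace_continuousP => u uB; apply/cvgrPdist_lt => e e0.
  (* The displacement is Lipschitz with constant [|q| + 1]; the absolute value covers a negative
     [q]. *)
  have e1 : 0 < e / (`|q| + 1) by rewrite divr_gt0 // ltr_wpDl.
  have : enorm (v - u) @[v --> u] --> (0 : R).
    by rewrite -enorm0 -(subrr u); exact: continuous_enormB.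
  move=> /cvgrPdist_lt /(_ _ e1) near_u.
  rewrite near_withinE; near=> v => vB.
  have : `|0 - enorm (v - u)| < e / (`|q| + 1) by near: v.
  rewrite sub0r normrN ger0_norm ?enorm_ge0 // ltr_pdivlMr ?ltr_wpDl //.
  apply: le_lt_trans.
  have Tuv : enorm (T u - T v) <= `|q| * enorm (v - u).
    rewrite (le_trans (Tq _ _ _ _)) ?inE // enorm_distC.
    by rewrite ler_wpM2r ?enorm_ge0 ?ler_norm.
  have h1 := enormD (T u - T v) (v - u); have h2 := enormD (T v - T u) (u - v).
  have h3 := enormD ((T u - T v) + (v - u)) (T v - v).
  have h4 := enormD ((T v - T u) + (u - v)) (T u - u).
  have e3 : (T u - T v) + (v - u) + (T v - v) = T u - u.
    by apply/rowP => i; rewrite !mxE; ring.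
  have e4 : (T v - T u) + (u - v) + (T u - u) = T v - v.
    by apply/rowP => i; rewrite !mxE; ring.
  rewrite e3 in h3; rewrite e4 in h4.
  rewrite (enorm_distC (T v) (T u)) (enorm_distC u v) in h2 h4.
  rewrite ler_norml; apply/andP; split; rewrite /from_subspace /=; lra.
- rewrite inE in uB; exists u => //; apply/eqP.
  rewrite -subr_eq0 -enorm_eq0; apply/negPn/negP => Tu0.
  have Tu : 0 < enorm (T u - u) by rewrite lt_def Tu0 enorm_ge0.
  have TuB := Tball _ uB.
  have h1 := umin (T u) (mem_set TuB).
  have h2 := Tq _ _ (mem_set TuB) (mem_set uB).
  have : q * enorm (T u - u) < enorm (T u - u) by rewrite gtr_pMl.
  lra.
Unshelve. all: end_near.
Qed.

End EuclideanTheory.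

(** * The induced norm of a matrix acting on rows *)

Section OperatorNorm.
Variables (R : realType) (p q : nat).

Lemma dot_mulmx_tr (u : 'rV[R]_p) (A : 'M[R]_(p, q)) (v : 'rV[R]_q) :
  dot (u *m A) v = dot u (v *m A^T).
Proof. by rewrite /dot trmx_mul trmxK mulmxA. Qed.

(** Makes the [sup] in [opnorm] meaningful: the coordinates of a vector of the unit ball are at most
    1 in absolute value, so the row norms of [A] sum to an upper bound. *)
Lemma has_sup_opnorm (A : 'M[R]_(p, q)) :
  has_sup [set enorm (v *m A) | v in [set v : 'rV[R]_p | enorm v <= 1]].
Proof.
split; first by exists (enorm (0 *m A)); exists 0 => //=; rewrite enorm0.
exists (\sum_i enorm (row i A)) => _ [v /= v1 <-].
rewrite mulmx_sum_row (le_trans (enorm_sum _)) // ler_sum // => i _.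
by rewrite enormZ ler_piMl ?enorm_ge0 // (le_trans (coord_le_enorm _ _)).
Qed.

Lemma opnorm_ge0 (A : 'M[R]_(p, q)) : 0 <= opnorm A.
Proof.
apply: (@le_trans _ _ (enorm (0 *m A))); first exact: enorm_ge0.
apply: ub_le_sup; first by case: (has_sup_opnorm A).
by exists 0 => //=; rewrite enorm0.
Qed.

Lemma opnormN (A : 'M[R]_(p, q)) : opnorm (- A) = opnorm A.
Proof.
by rewrite /opnorm; congr (sup (image _ _)); apply/funext => u; rewrite mulmxN enormN.
Qed.

Lemma enorm_mulmx_le (A : 'M[R]_(p, q)) (u : 'rV[R]_p) :
  enorm (u *m A) <= opnorm A * enorm u.
Proof.
have [->|u0] := eqVneq u 0; first by rewrite mul0mx !enorm0 mulr0.
have u1 : 0 < enorm u by rewrite lt_def enorm_eq0 u0 enorm_ge0.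
rewrite -ler_pdivrMr // mulrC -[X in X * _]ger0_norm ?invr_ge0 ?enorm_ge0 //.
rewrite -enormZ scalemxAl; apply: ub_le_sup; first by case: (has_sup_opnorm A).
exists ((enorm u)^-1 *: u) => //=.
by rewrite enormZ ger0_norm ?invr_ge0 ?enorm_ge0 // mulVf ?gt_eqF.
Qed.

Lemma opnorm_le_mulmx (A : 'M[R]_(p, q)) k (u : 'rV[R]_p) :
  opnorm A <= k -> enorm (u *m A) <= k * enorm u.
Proof.
by move=> Ak; rewrite (le_trans (enorm_mulmx_le _ _)) // ler_wpM2r ?enorm_ge0.
Qed.

End OperatorNorm.

(** * Jacobian of F and Taylor remainder *)

Section MatrixDifferential.
Variables (R : realType) (V : normedModType R) (p q : nat).
Implicit Types (f : V -> 'M[R]_(p, q)).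

Lemma differentiable_mx f x :
  (forall i j, differentiable (fun y => f y i j) x) -> differentiable f x.
Proof.
move=> df; rewrite (_ : f = \sum_(i < p) \sum_(j < q)
    (fun y => f y i j *: (delta_mx i j : 'M[R]_(p, q)))); last first.
  apply/funext => y; rewrite fct_sumE {1}(matrix_sum_delta (f y)).
  by apply: eq_bigr => i _; rewrite fct_sumE.
by do 2 apply: differentiable_sum => ?; apply: differentiableZl.
Qed.

Lemma differentiable_mx_coord f x i j :
  differentiable f x -> differentiable (fun y => f y i j) x.
Proof.
move=> df; apply: (@differentiable_comp _ _ _ _ f (fun M => M i j)) => //.
exact: differentiable_coord.
Qed.

Lemma diff_mx f x v i j :
  differentiable f x -> ('d f x v) i j = 'd (fun y => f y i j) x v.
Proof.
move=> df; rewrite -deriveE // derive_mx ?mxE; last exact: diff_derivable.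
by rewrite deriveE //; exact: differentiable_mx_coord.
Qed.

End MatrixDifferential.

(** * Differentiability and block Jacobian of F *)

Section JacobianF.
Variables (R : realType) (n m : nat).
Variables (c : 'rV[R]_n) (g : 'rV[R]_n -> 'rV[R]_m).
Hypothesis g_diff2 : twice_differentiable g.
Implicit Types z : 'rV[R]_(n + m).

Let g_diff x : differentiable g x. Proof. by case: g_diff2. Qed.

Lemma gradientE i x k : gradient g i x 0 k = 'J g x k i.
Proof. by rewrite /gradient !mxE. Qed.

Lemma differentiable_gradient i x : differentiable (gradient g i) x.
Proof.
apply: differentiable_mx => a k; rewrite (ord1 a).
rewrite (_ : (fun y => _) = fun y => 'J g y k i); last first.
  by apply/funext => y; rewrite gradientE.
by apply: differentiable_mx_coord; case: g_diff2.
Qed.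

(** A coordinate of c + g'(x)^T y, with y_i written as a coordinate of [z] so that the product rule
    for scalar functions applies. *)
Definition F_coordl k z : R :=
  c 0 k + \sum_(i < m) z 0 (rshift n i) * gradient g i (lsubmx z) 0 k.

Lemma Fmap_lshift z k : Fmap c g z 0 (lshift m k) = F_coordl k z.
Proof.
rewrite /Fmap row_mxEl !mxE; congr (_ + _); apply: eq_bigr => i _.
by rewrite gradientE !mxE.
Qed.

Lemma Fmap_rshift z k : Fmap c g z 0 (rshift n k) = g (lsubmx z) 0 k.
Proof. by rewrite /Fmap row_mxEr. Qed.

Let is_diff_lsubmx_comp q (h : 'rV[R]_n -> 'rV[R]_q) z i :
    differentiable h (lsubmx z) ->
  is_diff z (fun y => h (lsubmx y) 0 i)
            (fun v => ('d h (lsubmx z) (lsubmx v)) 0 i).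
Proof.
move=> dh.
have dl : differentiable (lsubmx : 'rV[R]_(n + m) -> _) z.
  exact: differentiable_lsubmx.
have dhl : differentiable (fun y : 'rV[R]_(n + m) => h (lsubmx y)) z.
  exact: (@differentiable_comp _ _ _ _ lsubmx h).
apply: DiffDef; first exact: differentiable_mx_coord.
apply/funext => v; rewrite -diff_mx //.
rewrite (@diff_comp _ _ _ _ lsubmx h) //= diff_lin //.
exact: continuous_lsubmx.
Qed.

Lemma is_diff_F_coordl z k : is_diff z (F_coordl k)
  (fun v => \sum_(i < m) (rsubmx v 0 i * gradient g i (lsubmx z) 0 k
     + rsubmx z 0 i * ('d (gradient g i) (lsubmx z) (lsubmx v)) 0 k)).
Proof.
pose t i : 'rV[R]_(n + m) -> R :=
  fun y => y 0 (rshift n i) * gradient g i (lsubmx y) 0 k.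
have dt i : is_diff z (t i) (fun v => rsubmx v 0 i * gradient g i (lsubmx z) 0 k
     + rsubmx z 0 i * ('d (gradient g i) (lsubmx z) (lsubmx v)) 0 k).
  have d1 : is_diff z (fun y : 'rV[R]_(n + m) => y 0 (rshift n i) : R)
              (fun v => rsubmx v 0 i).
    have dc : differentiable (fun y : 'rV[R]_(n + m) => y 0 (rshift n i)) z.
      exact: differentiable_coord.
    apply: DiffDef => //.
    apply/funext => v; rewrite -(diff_mx v 0 (rshift n i) (f := id)) //.
    by rewrite diff_val mxE.
  have d2 := is_diff_lsubmx_comp k (differentiable_gradient i (lsubmx z)).
  apply: is_diff_eq (is_diffM _ _) _.
  apply/funext => v /=; rewrite !fctE /= [RHS]addrC.
  by rewrite [rsubmx z 0 i]mxE [X in _ = _ + X]mulrC.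
rewrite (_ : F_coordl k = cst (c 0 k) + \sum_(i < m) t i); last first.
  by apply/funext => y; rewrite !fctE fct_sumE.
have dsum : differentiable (\sum_(i < m) t i) z.
  by apply: differentiable_sum => i.
apply: DiffDef; first exact: differentiableD.
rewrite diffD // diff_cst; apply/funext => v /=.
rewrite add0r -deriveE // derive_sum; last by move=> i; exact: diff_derivable.
by apply: eq_bigr => i _; rewrite deriveE // diff_val.
Qed.

Lemma differentiable_Fmap z : differentiable (Fmap c g) z.
Proof.
apply: differentiable_mx => a k; rewrite (ord1 a).
rewrite -(splitK k); case: (fintype.split k) => j /=.
- rewrite (_ : (fun y => _) = F_coordl j); first by case: (is_diff_F_coordl z j).
  by apply/funext => y; rewrite Fmap_lshift.
- rewrite (_ : (fun y => _) = fun y => g (lsubmx y) 0 j).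
    by case: (is_diff_lsubmx_comp j (g_diff (lsubmx z))).
  by apply/funext => y; rewrite Fmap_rshift.
Qed.

(** In the row convention a direction (dx, dy) is sent to (dx Hess + dy g'^T, dx g'). The subproblem
    alters this matrix by putting [H] in the Hessian block. *)
Lemma jacobian_Fmap z : 'J (Fmap c g) z =
  block_mx (hessian_lagrangian g z) ('J g (lsubmx z)) ('J g (lsubmx z))^T 0.
Proof.
(* A row is the image of a basis vector under the differential, which is compared coordinate by
   coordinate. *)
apply/row_matrixP => l; rewrite !rowE; set v := delta_mx _ _.
rewrite {1}/jacobian mul_rV_lin1.
rewrite -{2}(hsubmxK v) mul_row_block mulmx0 addr0.
apply/rowP => k; rewrite diff_mx; last exact: differentiable_Fmap.
rewrite -(splitK k); case: (fintype.split k) => j /=.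
- rewrite row_mxEl (_ : (fun y => _) = F_coordl j); last first.
    by apply/funext => y; rewrite Fmap_lshift.
  case: (is_diff_F_coordl z j) => _ ->.
  rewrite big_split /= addrC [RHS]mxE; congr (_ + _); last first.
    by rewrite mxE; apply: eq_bigr => i _; rewrite gradientE !mxE.
  rewrite /hessian_lagrangian mulmx_sumr summxE; apply: eq_bigr => i _.
  by rewrite -scalemxAr [RHS]mxE /hessian /jacobian mul_rV_lin1.
- rewrite row_mxEr (_ : (fun y => _) = fun y => g (lsubmx y) 0 j); last first.
    by apply/funext => y; rewrite Fmap_rshift.
  case: (is_diff_lsubmx_comp j (g_diff (lsubmx z))) => _ ->.
  by rewrite /jacobian mul_rV_lin1.
Qed.

End JacobianF.

(** * Quadratic bound on the first-order Taylor remainder *)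

Section QuadraticRemainder.
Variables (R : realType) (p q : nat) (f : 'rV[R]_p -> 'rV[R]_q).

(* Mean value theorem applied to t |-> <w, f (a + t d) - t d f'(a)>, where w is
   the remainder itself. *)
Lemma taylor1_remainder_le (a x : 'rV[R]_p) (L r : R) :
    (forall y, differentiable f y) -> 0 <= L ->
    (forall y, enorm (y - a) < r ->
       opnorm ('J f y - 'J f a) <= L * enorm (y - a)) ->
    enorm (x - a) < r ->
  enorm (f x - f a - (x - a) *m 'J f a) <= L * enorm (x - a) ^+ 2.
Proof.
move=> df L0 fL xr; set w := f x - f a - _; set d := x - a in xr w *.
pose phi (t : R) : R :=
  dot w (f (t *: d + a)) - t * dot w (d *m 'J f a).
pose dphi (t : R) : R := dot w (d *m ('J f (t *: d + a) - 'J f a)).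
have phi' (t : R) : is_derive t (1 : R) phi (dphi t).
  have dline : is_diff t (fun s : R => s *: d + a) (fun s => s *: d).
    apply: (is_diff_eq (is_diffD (is_diff_scalel t d) (is_diff_cst a t))).
    by apply/funext => s; rewrite fctE /= addr0.
  have dfl : is_diff t (fun s : R => f (s *: d + a))
                       (fun s => 'd f (t *: d + a) (s *: d)).
    have dft := differentiableP (df (t *: d + a)).
    exact: (is_diff_comp dline dft).
  have dcoord i : is_derive t (1 : R) (fun s : R => w 0 i * f (s *: d + a) 0 i)
      (w 0 i * (d *m 'J f (t *: d + a)) 0 i).
    have dfi : is_derive t (1 : R) (fun s : R => f (s *: d + a) 0 i)
        ((d *m 'J f (t *: d + a)) 0 i).
      apply: DeriveDef.
        by apply: diff_derivable; apply: differentiable_mx_coord.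
      rewrite deriveE; last by apply: differentiable_mx_coord.
      by rewrite -diff_mx // diff_val scale1r /jacobian mul_rV_lin1.
    exact: (is_deriveZ (w 0 i) dfi).
  have dsum := is_derive_sum dcoord.
  have dlin : is_derive t (1 : R) (fun s : R => s * dot w (d *m 'J f a))
                            (dot w (d *m 'J f a)).
    apply: (is_derive_eq (is_deriveM (is_derive_id t (1 : R)) (is_derive_cst _ _ _))).
    by rewrite /= scaler0 add0r /cst; rewrite /GRing.scale /= mulr1.
  rewrite (_ : phi = \sum_(i < q) (fun s : R => w 0 i * f (s *: d + a) 0 i)
                  - (fun s => s * dot w (d *m 'J f a))); last first.
    by apply/funext => s; rewrite /phi dotE !fctE fct_sumE.
  apply: (is_derive_eq (is_deriveB dsum dlin)).
  by rewrite /dphi mulmxBr dotBr; congr (_ - _); rewrite dotE.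
have phi_cont : {within `[0, 1], continuous phi}.
  apply: derivable_within_continuous => t _.
  by case: (phi' t).
have [t /itvP t01] := MVT ltr01 (fun t _ => phi' t) phi_cont.
rewrite subr0 mulr1 => phiE.
(* As [w] is the remainder, phi(1) - phi(0) is <w, w>. *)
have : enorm w ^+ 2 = dphi t.
  rewrite -phiE /phi scale1r scale0r add0r mul1r mul0r subr0 subrK enorm_sqr.
  by rewrite addrAC -!dotBr.
(* Of the intermediate [t] only 0 <= t <= 1 is used, hence the constant [L] instead of L / 2. *)
have tr : enorm (t *: d) <= enorm d.
  by rewrite enormZ ler_piMl ?enorm_ge0 // ger0_norm ?t01.
have : dphi t <= enorm w * (L * enorm d ^+ 2).
  rewrite (le_trans (dot_le _ _)) // ler_wpM2l ?enorm_ge0 //.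
  rewrite (le_trans (opnorm_le_mulmx _ (fL _ _))) ?addrK //.
    exact: le_lt_trans tr xr.
  by rewrite expr2 mulrA ler_wpM2r ?enorm_ge0 // ler_wpM2l.
move=> h e; rewrite -e in h.
have [w0|w0] := eqVneq (enorm w) 0; first by rewrite w0 mulr_ge0 ?sqr_ge0.
by move: h; rewrite expr2 ler_pM2l // lt_def w0 enorm_ge0.
Qed.

End QuadraticRemainder.

(** * KKT points of the subproblem *)

Section Blocks.
Variables (R : realType) (n m : nat).
Implicit Types z w : 'rV[R]_(n + m).

Lemma dot_hsubmx z w :
  dot z w = dot (lsubmx z) (lsubmx w) + dot (rsubmx z) (rsubmx w).
Proof.
by rewrite /dot -{1}(hsubmxK z) -{1}(hsubmxK w) tr_row_mx mul_row_col mxE.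
Qed.

Lemma enorm_hsubmx_sqr z :
  enorm z ^+ 2 = enorm (lsubmx z) ^+ 2 + enorm (rsubmx z) ^+ 2.
Proof. by rewrite !enorm_sqr dot_hsubmx. Qed.

Lemma enorm_lsubmx_le z : enorm (lsubmx z) <= enorm z.
Proof.
by rewrite -ler_sqr ?nnegrE ?enorm_ge0 // enorm_hsubmx_sqr lerDl sqr_ge0.
Qed.

Lemma enorm_rsubmx_le z : enorm (rsubmx z) <= enorm z.
Proof.
by rewrite -ler_sqr ?nnegrE ?enorm_ge0 // enorm_hsubmx_sqr lerDr sqr_ge0.
Qed.

Lemma enorm_row_mxr0 (x : 'rV[R]_n) : enorm (row_mx x (0 : 'rV[R]_m)) = enorm x.
Proof. by rewrite /enorm dot_hsubmx row_mxKl row_mxKr dot0l addr0. Qed.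

Lemma enorm_row_mx0l (y : 'rV[R]_m) : enorm (row_mx (0 : 'rV[R]_n) y) = enorm y.
Proof. by rewrite /enorm dot_hsubmx row_mxKl row_mxKr dot0l add0r. Qed.

(** The multiplier part of K is the whole space, so the normal cone is that of [Omega] times {0}. *)
Lemma normal_cone_Kset (Omega : set 'rV[R]_n) z w :
  normal_cone (Kset Omega) z w <->
  normal_cone Omega (lsubmx z) (lsubmx w) /\ rsubmx w = 0.
Proof.
split=> [[Kz zw]|[[Oz zw] w0]]; last first.
  split => // v Kv; rewrite dot_hsubmx w0 dot0l addr0 linearB; exact: zw.
split.
  split => // v Ov; have := zw (row_mx v (rsubmx z)).
  rewrite /Kset /= row_mxKl => /(_ Ov).
  by rewrite dot_hsubmx !linearB /= row_mxKl row_mxKr subrr dot0r addr0.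
(* Moving y by the normal's own second block w_y yields 0 <= - <w_y, w_y>. *)
have := zw (row_mx (lsubmx z) (rsubmx z + rsubmx w)).
rewrite /Kset /= row_mxKl => /(_ Kz).
rewrite dot_hsubmx !linearB /= row_mxKl row_mxKr subrr dot0r add0r.
rewrite opprD addNKr dotNr oppr_ge0 => w0; apply/eqP; rewrite -dot_eq0.
by rewrite eq_le w0 dot_ge0.
Qed.

Lemma image_addP p (a b : 'rV[R]_p) (N : set 'rV[R]_p) :
  [set a + u | u in N] b <-> N (b - a).
Proof.
split=> [[u Nu <-]|Nba]; first by rewrite addrC addKr.
by exists (b - a) => //; rewrite addrC subrK.
Qed.

Lemma block_mx_symB (A A' : 'M[R]_n) (B C : 'M[R]_(n, m)) :
  block_mx A B B^T 0 - block_mx A' C C^T 0 =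
  block_mx (A - A') (B - C) (B - C)^T (0 : 'M[R]_m).
Proof. by rewrite opp_block_mx add_block_mx subrr [(B - C)^T]linearB. Qed.

(* kD bounds B and its transpose as off-diagonal blocks; A' is arbitrary. *)
Lemma enorm_mulmx_block_le (A A' : 'M[R]_n) (B : 'M[R]_(n, m)) kA kD z :
    opnorm A <= kA -> opnorm (block_mx A' B B^T 0) <= kD ->
  enorm (z *m block_mx A B B^T 0) <= (kA + 2 * kD) * enorm z.
Proof.
move=> hA hD.
(* Apply the block matrix to (x, 0) and keep only the second block of the image, in which [A'] does
   not occur. *)
have hB (x : 'rV[R]_n) : enorm (x *m B) <= kD * enorm x.
  have := opnorm_le_mulmx (row_mx x 0) hD; rewrite enorm_row_mxr0.
  apply: le_trans; rewrite mul_row_block !mul0mx !addr0.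
  by have := enorm_rsubmx_le (row_mx (x *m A') (x *m B)); rewrite row_mxKr.
have hBT (y : 'rV[R]_m) : enorm (y *m B^T) <= kD * enorm y.
  have := opnorm_le_mulmx (row_mx 0 y) hD; rewrite enorm_row_mx0l.
  apply: le_trans; rewrite mul_row_block !mul0mx !add0r mulmx0.
  by have := enorm_lsubmx_le (row_mx (y *m B^T) (0 : 'rV[R]_m)); rewrite row_mxKl.
have kA0 := le_trans (opnorm_ge0 _) hA; have kD0 := le_trans (opnorm_ge0 _) hD.
rewrite -{1}(hsubmxK z) mul_row_block mulmx0 addr0.
set x := lsubmx z; set y := rsubmx z.
(* Three pieces: [A] costs [kA], while [B] and its transpose cost [kD] each. *)
have -> : row_mx (x *m A + y *m B^T) (x *m B) =
    row_mx (x *m A) 0 + row_mx (y *m B^T) 0 + row_mx 0 (x *m B).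
  by rewrite !add_row_mx !addr0 add0r.
have h1 := enormD (row_mx (x *m A) 0 + row_mx (y *m B^T) 0) (row_mx 0 (x *m B)).
have h2 := enormD (row_mx (x *m A) (0 : 'rV[R]_m)) (row_mx (y *m B^T) 0).
rewrite !enorm_row_mxr0 enorm_row_mx0l in h1 h2.
have h3 := opnorm_le_mulmx x hA.
have h4 := ler_wpM2l kA0 (enorm_lsubmx_le z).
have h5 := ler_wpM2l kD0 (enorm_lsubmx_le z).
have h6 := ler_wpM2l kD0 (enorm_rsubmx_le z).
have := hB x; have := hBT y; rewrite -/x -/y in h4 h5 h6; lra.
Qed.

End Blocks.

Lemma convex_set_combination (R : realType) n (A : set 'rV[R]_n) x y (t : R) :
  convex_set A -> 0 <= t <= 1 -> A x -> A y -> A (t *: x + (1 - t) *: y).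
Proof.
move=> cA /andP[t0 t1] Ax Ay.
by have := cA x y (Itv01 t0 t1) (mem_set Ax) (mem_set Ay); rewrite inE.
Qed.

(** A nonnegative quadratic form has zero gradient where it vanishes; otherwise a small step from
    [d] against w = d H would make it negative. *)
Lemma psd_dot_eq0 (R : realType) n (H : 'M[R]_n) (d : 'rV[R]_n) :
  psd H -> dot (d *m H) d <= 0 -> d *m H = 0.
Proof.
move=> [HT H0] dd; apply/eqP; rewrite -dot_eq0; set w := d *m H in dd *.
apply/negPn/negP => ww0.
have ww : 0 < dot w w by rewrite lt_def ww0 dot_ge0.
set s := dot (w *m H) w; have s0 : 0 <= s by exact: H0.
(* Then t^2 s = t |w|^2 - t^2, so the form at d - t w is at most - t |w|^2 - t^2 < 0. The added 1
   covers s = 0. *)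
pose t := dot w w / (s + 1).
have t0 : 0 < t by rewrite divr_gt0 // ltr_wpDl.
have ts : t * (s + 1) = dot w w by rewrite divfK // gt_eqF // ltr_wpDl.
have := H0 (d - t *: w); rewrite mulmxBl -scalemxAl -/w.
rewrite dotBl !dotBr !dotZl !dotZr [dot (w *m H) d]dot_mulmx_tr HT -/w -/s => h.
have h2 : t * (t * s) = t * dot w w - t * t by rewrite -ts; ring.
have h3 : 0 < t * dot w w by rewrite mulr_gt0.
have h4 : 0 < t * t by rewrite mulr_gt0.
clear HT; lra.
Qed.

(** * Convexity and uniqueness of KKT points, and the subproblem as a perturbed generalized
    equation *)

Section Subproblem.
Variables (R : realType) (n m : nat).
Variables (c : 'rV[R]_n) (g : 'rV[R]_n -> 'rV[R]_m) (Omega : set 'rV[R]_n).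
Implicit Types (z w : 'rV[R]_(n + m)) (H : 'M[R]_n).

Lemma sub_KKT_variational xj H z : sub_KKT c g Omega xj H z <->
  [/\ Omega (lsubmx z), linearized_zero g xj (lsubmx z) & forall v, Omega v ->
    0 <= dot (c + (lsubmx z - xj) *m H + rsubmx z *m ('J g xj)^T) (v - lsubmx z)].
Proof.
rewrite /sub_KKT /mkset image_addP sub0r; split=> [[[Oz zv] lz]|[Oz lz zv]].
  by split => // v /zv; rewrite dotNl -dotNr opprB.
by split => //; split => // v /zv; rewrite dotNl -dotNr opprB.
Qed.

Lemma linearized_zero_dir xj x x' :
  linearized_zero g xj x -> linearized_zero g xj x' -> (x - x') *m 'J g xj = 0.
Proof.
rewrite /linearized_zero /= => lx lx'.
rewrite -(subrKA xj) mulmxDl -[xj - x']opprB mulNmx.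
by rewrite -(addrKA (g xj)) ![_ + g xj]addrC lx lx' subrr.
Qed.

(* The constraint term y g'(xj)^T is orthogonal to the differences of feasible
   points, so two KKT points have the same image under H, and the gradients of
   the Lagrangian at both are orthogonal to the segment joining them. *)
Lemma convex_sub_KKT xj H z w (t : R) :
    convex_set Omega -> psd H -> 0 <= t <= 1 ->
    sub_KKT c g Omega xj H z -> sub_KKT c g Omega xj H w ->
  sub_KKT c g Omega xj H (t *: z + (1 - t) *: w).
Proof.
move=> Oconv Hpsd t01 /sub_KKT_variational[Oz lz vz] /sub_KKT_variational[Ow lw vw].
have /andP[t0 t1] := t01.
set x := lsubmx z in Oz lz vz *; set x' := lsubmx w in Ow lw vw *.
set y := rsubmx z in vz; set y' := rsubmx w in vw.
set G := c + (x - xj) *m H + y *m _ in vz.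
set G' := c + (x' - xj) *m H + y' *m _ in vw.
set d := x - x'.
have dJ : d *m 'J g xj = 0 by exact: linearized_zero_dir.
have GG' : G - G' = d *m H + (y - y') *m ('J g xj)^T.
  rewrite /G /G' /d !mulmxBl; apply/rowP => i; rewrite !mxE; ring.
have yJ (u : 'rV[R]_m) : dot (u *m ('J g xj)^T) d = 0.
  by rewrite dot_mulmx_tr trmxK dJ dot0r.
(* Each variational inequality is tested at the other point, so <G, d> <= 0 <= <G', d>. As <G - G',
   d> = <d H, d>, this forces d H = 0, and then both products vanish. *)
have h1 : 0 <= dot G (- d) by rewrite /d opprB; exact: vz.
have h2 : 0 <= dot G' d by exact: vw.
have GG'd : dot (G - G') d = dot (d *m H) d by rewrite GG' dotDl yJ addr0.
have dH : d *m H = 0.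
  by apply: psd_dot_eq0 => //; rewrite -GG'd dotBl; rewrite dotNr in h1; lra.
have Gd : dot G d = dot G' d.
  by apply/eqP; rewrite -subr_eq0 -dotBl GG'd dH dot0l.
have Gd0 : dot G d = 0 by rewrite dotNr in h1; lra.
have lE : lsubmx (t *: z + (1 - t) *: w) = t *: x + (1 - t) *: x'.
  by rewrite linearD !linearZ.
have rE : rsubmx (t *: z + (1 - t) *: w) = t *: y + (1 - t) *: y'.
  by rewrite linearD !linearZ.
apply/sub_KKT_variational; rewrite lE rE.
have xt : t *: x + (1 - t) *: x' = x' + t *: d.
  by apply/rowP => i; rewrite !mxE; ring.
split.
- exact: convex_set_combination.
- rewrite xt /linearized_zero /= addrAC mulmxDl -scalemxAl dJ scaler0 addr0.
  exact: lw.
- move=> v Ov; set Gt := c + _ + _.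
  (* The gradient of the Lagrangian is affine in (x, y). *)
  have -> : Gt = t *: G + (1 - t) *: G'.
    have e : (t *: x + (1 - t) *: x' - xj) *m H =
        t *: ((x - xj) *m H) + (1 - t) *: ((x' - xj) *m H).
      rewrite !scalemxAl -mulmxDl; congr (_ *m _).
      by apply/rowP => i; rewrite !mxE; ring.
    rewrite /Gt /G /G' e [(t *: y + _) *m _]mulmxDl -!scalemxAl.
    by apply/rowP => i; rewrite !mxE; ring.
  (* [v] minus the new point differs from v - x and from v - x' by multiples of [d], to which [G]
     and [G'] are orthogonal. *)
  have -> : v - (t *: x + (1 - t) *: x') = v - x + (1 - t) *: d.
    by apply/rowP => i; rewrite !mxE; ring.
  have e' : v - x + (1 - t) *: d = v - x' - t *: d.
    by apply/rowP => i; rewrite !mxE; ring.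
  have Gv : 0 <= dot G (v - x + (1 - t) *: d).
    by rewrite dotDr dotZr Gd0 mulr0 addr0; exact: vz.
  have G'v : 0 <= dot G' (v - x + (1 - t) *: d).
    by rewrite e' dotBr dotZr -Gd Gd0 mulr0 subr0; exact: vw.
  by rewrite dotDl !dotZl addr_ge0 // mulr_ge0 // subr_ge0.
Qed.

(** Along a difference [d] of feasible points the multiplier term vanishes, and the objective
    changes by <gradient, d> + <d H, d> / 2, a sum of nonnegative terms. *)
Lemma sub_KKT_solution xj H z :
    psd H -> sub_KKT c g Omega xj H z ->
  sub_solution c g Omega xj H (lsubmx z).
Proof.
move=> [HT H0] /sub_KKT_variational[Oz lz vz]; split => // x' [Ox' lx'].
set x := lsubmx z in Oz lz vz *; set d := x' - x.
have dJ : d *m 'J g xj = 0 by exact: linearized_zero_dir.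
have := vz _ Ox'; rewrite -/d !dotDl
   [dot (rsubmx z *m _) d]dot_mulmx_tr trmxK dJ dot0r addr0.
have -> : x' = x + d by rewrite addrC subrK.
move: (H0 d).
rewrite /sub_objective addrAC; set e := x - xj.
clearbody d e; rewrite mulmxDl !dotDl !dotDr
  [dot (d *m H) e]dot_mulmx_tr HT [dot d (e *m H)]dotC.
by clear HT dJ; lra.
Qed.

(** The segment from [z] to another KKT point consists of KKT points, and its part close to [z] lies
    in the ball, where [z] is the only one. *)
Lemma sub_KKT_unique xj H zs z r :
    convex_set Omega -> psd H ->
    sub_KKT c g Omega xj H z -> enorm (z - zs) < r ->
    (forall w, enorm (w - zs) <= r -> sub_KKT c g Omega xj H w -> w = z) ->
  sub_KKT c g Omega xj H = [set z].
Proof.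
move=> Oconv Hpsd Kz zr uz; apply/seteqP; split => [w Kw|_ -> //] /=.
set gap := r - enorm (z - zs); have gap0 : 0 < gap by rewrite subr_gt0.
have gw : 0 < gap + enorm (w - z) by rewrite ltr_wpDr ?enorm_ge0.
(* Gives t > 0 and t |w - z| <= gap, also when w = z. *)
pose t := gap / (gap + enorm (w - z)).
have t0 : 0 < t by rewrite divr_gt0.
have t1 : t <= 1 by rewrite ler_pdivrMr // mul1r lerDl enorm_ge0.
have tgap : t * enorm (w - z) <= gap.
  by rewrite mulrAC ler_pdivrMr // ler_pM2l // lerDr ltW.
have : t *: w + (1 - t) *: z = z.
  apply: uz; last by apply: convex_sub_KKT => //; rewrite ltW.
  have -> : t *: w + (1 - t) *: z - zs = t *: (w - z) + (z - zs).
    by apply/rowP => i; rewrite !mxE; ring.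
  rewrite (le_trans (enormD _ _)) // enormZ ger0_norm ?(ltW t0) //.
  by rewrite /gap in tgap; lra.
move=> e; apply/eqP; rewrite -subr_eq0.
have : t *: (w - z) == 0.
  rewrite (_ : t *: (w - z) = t *: w + (1 - t) *: z - z); first by rewrite e subrr.
  by apply/rowP => i; rewrite !mxE; ring.
by rewrite scaler_eq0 gt_eqF.
Qed.

(** The linear model of F at [zj] with [H] as Hessian block. The old multiplier in F(zj) cancels
    against that in z - zj, which leaves the KKT system of the subproblem. *)
Definition sub_map zj H z : 'rV[R]_(n + m) :=
  Fmap c g zj + (z - zj) *m
    block_mx H ('J g (lsubmx zj)) ('J g (lsubmx zj))^T 0.

Lemma sub_KKT_normal_cone zj H z : sub_KKT c g Omega (lsubmx zj) H z <->
  normal_cone (Kset Omega) z (- sub_map zj H z).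
Proof.
have -> : sub_map zj H z =
    row_mx (c + (lsubmx z - lsubmx zj) *m H + rsubmx z *m ('J g (lsubmx zj))^T)
      (g (lsubmx zj) + (lsubmx z - lsubmx zj) *m 'J g (lsubmx zj)).
  rewrite /sub_map -(hsubmxK (z - zj)) mul_row_block add_row_mx mulmx0 addr0.
  rewrite [lsubmx (z - zj)]linearB [rsubmx (z - zj)]linearB /=.
  congr row_mx; rewrite [(rsubmx z - _) *m _]mulmxBl.
  by apply/rowP => i; rewrite !mxE; ring.
rewrite normal_cone_Kset opp_row_mx row_mxKl row_mxKr.
rewrite /sub_KKT /mkset image_addP sub0r; split=> -[h1 h2]; split => //.
  by rewrite h2 oppr0.
by apply/eqP; rewrite -oppr_eq0 h2.
Qed.

Lemma linearized_GE_normal_cone zs delta z :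
  linearized_GE c g Omega zs delta z <-> normal_cone (Kset Omega) z
    (delta - (Fmap c g zs + (z - zs) *m 'J (Fmap c g) zs)).
Proof. exact: image_addP. Qed.

(** The affine map delta of the overview. It is evaluated at the unknown [z] itself, so KKT points
    of the subproblem become fixed points. *)
Definition sub_defect zs zj H z : 'rV[R]_(n + m) :=
  Fmap c g zs + (z - zs) *m 'J (Fmap c g) zs - sub_map zj H z.

Lemma sub_KKT_linearized_GE zs zj H z :
  sub_KKT c g Omega (lsubmx zj) H z <->
  linearized_GE c g Omega zs (sub_defect zs zj H z) z.
Proof.
rewrite sub_KKT_normal_cone linearized_GE_normal_cone /sub_defect.
by rewrite addrC addKr.
Qed.

(** * Size and Lipschitz constant of the defect *)

Section Estimates.
Variables (zs zj : 'rV[R]_(n + m)) (H : 'M[R]_n) (kappa omega r : R).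
Hypotheses (g_diff2 : twice_differentiable g) (omega_ge0 : 0 <= omega).
Hypothesis F_lip : forall z, enorm (z - zs) < r ->
  opnorm ('J (Fmap c g) z - 'J (Fmap c g) zs) <= omega * enorm (z - zs).
Hypothesis H_kappa : opnorm (hessian_lagrangian g zs - H) <= kappa.
Hypothesis zj_r : enorm (zj - zs) < r.
Let e := enorm (zj - zs).

Let D := 'J (Fmap c g) zs - block_mx H ('J g (lsubmx zj)) ('J g (lsubmx zj))^T 0.

Let enorm_mulD z : enorm (z *m D) <= (kappa + 2 * (omega * e)) * enorm z.
Proof.
rewrite /D jacobian_Fmap // block_mx_symB.
(* The free Hessian block is chosen to turn the auxiliary matrix into F'(zs) - F'(zj), whose norm is
   at most omega e. *)
apply: (@enorm_mulmx_block_le _ _ _ _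
  (hessian_lagrangian g zs - hessian_lagrangian g zj)) => //.
have := F_lip zj_r; rewrite -opnormN opprB !jacobian_Fmap //.
by rewrite block_mx_symB.
Qed.

Lemma sub_defect_lipschitz z w :
  enorm (sub_defect zs zj H z - sub_defect zs zj H w)
    <= (kappa + 2 * (omega * e)) * enorm (z - w).
Proof.
rewrite (_ : _ - _ = (z - w) *m D) //.
rewrite /sub_defect /sub_map /D mulmxBr !mulmxBl.
by apply/rowP => i; rewrite !mxE; ring.
Qed.

Lemma sub_defect_center :
  enorm (sub_defect zs zj H zs) <= (kappa + 3 * (omega * e)) * e.
Proof.
(* The [D] term costs kappa + 2 omega e per unit length, and the Taylor remainder of F at [zs] one
   more omega e. *)
have -> : sub_defect zs zj H zs = (zs - zj) *m D
    - (Fmap c g zj - Fmap c g zs - (zj - zs) *m 'J (Fmap c g) zs).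
  rewrite /sub_defect /sub_map /D subrr mul0mx addr0 mulmxBr !mulmxBl.
  by apply/rowP => i; rewrite !mxE; ring.
rewrite (le_trans (enormB _ _)) //.
have h1 := enorm_mulD (zs - zj); rewrite enorm_distC -/e in h1.
have h2 := taylor1_remainder_le (differentiable_Fmap c g_diff2) omega_ge0 F_lip zj_r.
rewrite -/e expr2 in h2; lra.
Qed.

End Estimates.
End Subproblem.

(** * Local convergence *)

Lemma near0_mul_lt (R : realType) (A B : R) :
  0 < A -> 0 <= B -> \forall r \near 0^'+, r * B < A.
Proof.
move=> A0 B0; have B1 : 0 < B + 1 by rewrite ltr_wpDl.
have AB : 0 < A / (B + 1) by rewrite divr_gt0.
near=> r.
have r0 : 0 < r by near: r; exact: nbhs_right_gt.
have : r < A / (B + 1) by near: r; exact: nbhs_right_lt.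
by rewrite ltr_pdivlMr // mulrDr mulr1; lra.
Unshelve. all: by end_near. Qed.

(** * Consequences of strong regularity near the KKT point *)

Section LocalAnalysis.
Variables (R : realType) (n m : nat).
Variables (c : 'rV[R]_n) (g : 'rV[R]_n -> 'rV[R]_m) (Omega : set 'rV[R]_n).
Hypotheses (Omega_convex : convex_set Omega) (g_diff2 : twice_differentiable g).
Variables (zs : 'rV[R]_(n + m)) (gamma rdelta rs : R).
Variable (s : 'rV[R]_(n + m) -> 'rV[R]_(n + m)).
Hypotheses (zs_KKT : is_KKT c g Omega zs).
Hypotheses (gamma_gt0 : 0 < gamma) (rdelta_gt0 : 0 < rdelta) (rs_gt0 : 0 < rs).
Hypothesis s_single : forall delta, eball 0 rdelta delta ->
  eball zs rs `&` linearized_GE c g Omega zs delta = [set s delta].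
Hypothesis s_lip : forall delta delta',
  eball 0 rdelta delta -> eball 0 rdelta delta' ->
  enorm (s delta - s delta') <= gamma * enorm (delta - delta').

Let s_sol delta : enorm delta < rdelta ->
  linearized_GE c g Omega zs delta (s delta).
Proof.
move=> d; have : [set s delta] (s delta) by [].
by rewrite -s_single => [[]|]; rewrite /eball /= ?subr0.
Qed.

Let s_uniq delta z : enorm delta < rdelta -> enorm (z - zs) < rs ->
  linearized_GE c g Omega zs delta z -> z = s delta.
Proof.
move=> d zr zd; suff : [set s delta] z by [].
by rewrite -s_single //= /eball /= subr0.
Qed.

Lemma is_KKT_normal_cone z :
  is_KKT c g Omega z <-> normal_cone (Kset Omega) z (- Fmap c g z).
Proof. by rewrite /is_KKT image_addP sub0r. Qed.

Lemma selection_0 : s 0 = zs.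
Proof.
apply/esym/s_uniq; rewrite ?enorm0 ?subrr ?enorm0 //.
apply/linearized_GE_normal_cone; rewrite subrr mul0mx addr0 sub0r.
exact/is_KKT_normal_cone.
Qed.

Lemma enorm_selection_le delta : enorm delta < rdelta ->
  enorm (s delta - zs) <= gamma * enorm delta.
Proof.
move=> d; rewrite -selection_0 -[X in gamma * enorm X](subr0 delta).
by apply: s_lip; rewrite /eball /= ?subr0 // enorm0.
Qed.

(** The composite of [s] with [delta] contracts the closed ball with factor [gamma * L]. The two
    bounds on |delta(zs)| + L r keep [delta] in the domain of [s] and the image in the ball. *)
Lemma perturbed_GE_solution (delta : 'rV[R]_(n + m) -> 'rV[R]_(n + m)) (L r : R) :
    (forall z w, enorm (delta z - delta w) <= L * enorm (z - w)) ->
    0 <= L -> gamma * L < 1 -> 0 <= r < rs ->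
    enorm (delta zs) + L * r < rdelta ->
    gamma * (enorm (delta zs) + L * r) <= r ->
  exists z, [/\ enorm (z - zs) <= r, linearized_GE c g Omega zs (delta z) z,
    enorm (z - zs) * (1 - gamma * L) <= gamma * enorm (delta zs) &
    forall w, enorm (w - zs) <= r ->
      linearized_GE c g Omega zs (delta w) w -> w = z].
Proof.
move=> dL L0 gL /andP[r0 rrs] dr gdr.
have d_le z : enorm (delta z) <= enorm (delta zs) + L * enorm (z - zs).
  have := enormD (delta zs) (delta z - delta zs).
  by have := dL z zs; rewrite [delta zs + _]addrC subrK; lra.
have d_lt z : enorm (z - zs) <= r -> enorm (delta z) < rdelta.
  move=> zr; apply: le_lt_trans (d_le z) _.
  by apply: le_lt_trans dr; rewrite lerD2l ler_wpM2l.
have T_le z : enorm (z - zs) <= r ->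
    enorm (s (delta z) - zs) <= gamma * (enorm (delta zs) + L * enorm (z - zs)).
  move=> zr; rewrite (le_trans (enorm_selection_le (d_lt _ zr))) //.
  by rewrite ler_pM2l.
have T_lip z w : enorm (z - zs) <= r -> enorm (w - zs) <= r ->
    enorm (s (delta z) - s (delta w)) <= gamma * L * enorm (z - w).
  move=> zr wr; rewrite (le_trans (s_lip _ _)) /eball /= ?subr0 ?d_lt //.
  by rewrite -mulrA ler_pM2l.
have [||z zr Tz] := @contraction_fixpoint_ecball _ _ (fun z => s (delta z))
    zs r _ r0 gL.
- move=> z zr; rewrite /ecball /= (le_trans (T_le _ zr)) //.
  by rewrite (le_trans _ gdr) // ler_pM2l // lerD2l ler_wpM2l.
- by move=> z w; rewrite !inE; exact: T_lip.
exists z; split => //.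
- by rewrite -{2}Tz; apply: s_sol; exact: d_lt.
- by have := T_le z zr; rewrite Tz; lra.
(* Since r < rs, a solution in the ball is the value of [s], hence a fixed point of the
   contraction. *)
- move=> w wr Kw; have wT : w = s (delta w).
    by apply: s_uniq => //; [exact: d_lt|exact: le_lt_trans rrs].
  have := T_lip w z wr zr; rewrite -wT Tz.
  have [//|wz] := eqVneq w z; rewrite ler_pMl; first by rewrite leNgt gL.
  by rewrite lt_def enorm_ge0 enorm_eq0 subr_eq0 wz.
Qed.

Variables (kappa omega r : R).
Hypotheses (kappa_ge0 : 0 <= kappa) (omega_ge0 : 0 <= omega).
Hypotheses (r_gt0 : 0 < r) (r_rs : r < rs).
Hypothesis F_lip : forall z, enorm (z - zs) < r ->
  opnorm ('J (Fmap c g) z - 'J (Fmap c g) zs) <= omega * enorm (z - zs).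
Hypothesis r_delta : r * (2 * (kappa + 3 * (omega * r))) < rdelta.
Hypothesis r_half : gamma * (kappa + 3 * (omega * r)) <= 1 / 2.

Let a := gamma * kappa.
Let alpha := a / (1 - a).
Let c1 := 12 * (gamma * omega).

Let gor_ge0 : 0 <= gamma * (3 * (omega * r)).
Proof. by rewrite !mulr_ge0 // ltW. Qed.

(** A KKT point solves the equation linearized at [zs] with minus its Taylor remainder on the right,
    so e <= gamma omega e^2; as gamma omega r <= 1/6, e must be 0. *)
Lemma KKT_locally_unique z :
  enorm (z - zs) < r -> is_KKT c g Omega z -> z = zs.
Proof.
move=> zr /is_KKT_normal_cone Kz.
set e := enorm (z - zs) in zr *.
pose delta := Fmap c g zs + (z - zs) *m 'J (Fmap c g) zs - Fmap c g z.
have d_le : enorm delta <= omega * (e * e).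
  rewrite /delta -enormN opprB opprD addrA -expr2.
  exact: taylor1_remainder_le (differentiable_Fmap c g_diff2) omega_ge0 F_lip zr.
have e0 : 0 <= e by exact: enorm_ge0.
have oe : omega * (e * e) <= (omega * r) * e.
  by rewrite -mulrA ler_wpM2l // ler_wpM2r // ltW.
have or0 : 0 <= omega * r by rewrite mulr_ge0 // ltW.
have h1 : (omega * r) * e <= (omega * r) * r by rewrite ler_wpM2l // ltW.
have h2 : 0 <= r * kappa by rewrite mulr_ge0 // ltW.
have h3 : 0 <= r * (omega * r) by rewrite mulr_ge0 // ltW.
have d_lt : enorm delta < rdelta.
  apply: le_lt_trans d_le _; apply: le_lt_trans oe _; apply: le_lt_trans h1 _.
  move: r_delta h2 h3. lra.
have zE : z = s delta.
  apply: s_uniq => //; first exact: lt_trans r_rs.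
  by apply/linearized_GE_normal_cone; rewrite /delta addrC addKr.
have := enorm_selection_le d_lt; rewrite -zE -/e => ed.
have h4 : gamma * enorm delta <= gamma * ((omega * r) * e).
  by rewrite ler_pM2l // (le_trans d_le).
have h5 : gamma * (3 * (omega * r)) <= 1 / 2.
  have : 0 <= gamma * kappa by rewrite mulr_ge0 // ltW.
  by move: r_half; rewrite mulrDr; lra.
have h6 := ler_wpM2r e0 h5.
by apply/eqP; rewrite -subr_eq0 -enorm_eq0 -/e; apply/eqP; lra.
Qed.

Let c1_ge0 : 0 <= c1. Proof. by rewrite !mulr_ge0 // ltW. Qed.

Let a_le : a <= 1 / 2.
Proof. by move: r_half gor_ge0; rewrite mulrDr -/a; lra. Qed.

Let alphaE : alpha * (1 - a) = a.
Proof. by rewrite divfK // gt_eqF //; move: a_le; lra. Qed.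

Lemma rate_le1 : alpha <= 1.
Proof. by rewrite ler_pdivrMr; move: a_le; lra. Qed.

Lemma scp_step_unique zj H :
    psd H -> opnorm (hessian_lagrangian g zs - H) <= kappa ->
    enorm (zj - zs) < r -> alpha + c1 * r < 1 ->
  exists z, [/\ scp_step c g Omega zj H z,
    sub_KKT c g Omega (lsubmx zj) H = [set z] &
    enorm (z - zs) <= (alpha + c1 * enorm (zj - zs)) * enorm (zj - zs)].
Proof.
move=> Hpsd Hk; set e := enorm (zj - zs) => er rate1.
have e0 : 0 <= e by exact: enorm_ge0.
pose b := gamma * (3 * (omega * e)).
have oe0 : 0 <= omega * e by rewrite mulr_ge0.
have oe : omega * e <= omega * r by rewrite ler_wpM2l // ltW.
have b0 : 0 <= b by rewrite !mulr_ge0 // ltW.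
have b_le : b <= gamma * (3 * (omega * r)) by rewrite ler_pM2l // ler_pM2l.
have ab : a + b <= 1 / 2 by move: r_half; rewrite mulrDr -/a; lra.
pose L := kappa + 2 * (omega * e).
have L0 : 0 <= L by rewrite addr_ge0 // mulr_ge0.
have gLE : gamma * L = a + 2 / 3 * b by rewrite /L /a /b; field.
have gL : gamma * L < 1 by rewrite gLE; lra.
have dc := sub_defect_center g_diff2 omega_ge0 F_lip Hk er.
rewrite -/e in dc.
(* M = kappa + 3 omega e bounds [L], and M e bounds the defect at [zs]. Both terms of the size
   conditions are thus at most M r, whence the 2 in [r_delta] and the 1/2 in [r_half]. *)
have M0 : 0 <= kappa + 3 * (omega * e) by rewrite addr_ge0 // mulr_ge0.
have Mle : kappa + 3 * (omega * e) <= kappa + 3 * (omega * r) by lra.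
have dc1 : (kappa + 3 * (omega * e)) * e <= (kappa + 3 * (omega * e)) * r.
  by rewrite ler_wpM2l // ltW.
have dc2 : (kappa + 3 * (omega * e)) * r <= (kappa + 3 * (omega * r)) * r.
  by rewrite ler_pM2r.
have Lr : L * r <= (kappa + 3 * (omega * e)) * r by rewrite ler_pM2r // /L; lra.
have gM : gamma * ((kappa + 3 * (omega * e)) * r) = (a + b) * r.
  by rewrite /a /b; ring.
have gMe : gamma * ((kappa + 3 * (omega * e)) * e) = (a + b) * e.
  by rewrite /a /b; ring.
have abr : (a + b) * r <= 1 / 2 * r by rewrite ler_pM2r.
have [|||z [zr Kz ze zu]] := perturbed_GE_solution
  (delta := sub_defect c g zs zj H) (L := L) (r := r)
  (sub_defect_lipschitz g_diff2 F_lip Hk er) L0 gL.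
- by rewrite r_rs ltW.
- by move: r_delta dc dc1 dc2 Lr; lra.
- apply: (@le_trans _ _ (gamma * ((kappa + 3 * (omega * e)) * r
                                  + (kappa + 3 * (omega * e)) * r))).
    by rewrite ler_pM2l // lerD // (le_trans dc).
  by rewrite mulrDr gM; lra.
have ze_lt : enorm (z - zs) <= (alpha + c1 * e) * e.
  have gd : gamma * enorm (sub_defect c g zs zj H zs) <= (a + b) * e.
    by rewrite -gMe ler_pM2l.
  have z1 : enorm (z - zs) * (1 - (a + b)) <= (a + b) * e.
    apply: le_trans gd; apply: le_trans ze.
    by rewrite ler_wpM2l ?enorm_ge0 // gLE; lra.
  have ab1 : 0 < 1 - (a + b) by lra.
  (* It remains to see a + b <= (alpha + 4 b)(1 - a - b). By alpha (1 - a) = a, alpha b <= b and 1 -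
     a - b >= 1/2, the right side is at least a - b + 2 b. *)
  rewrite -(ler_pM2r ab1); apply: le_trans z1 _.
  rewrite [leRHS]mulrAC ler_wpM2r //.
  have -> : c1 * e = 4 * b by rewrite /c1 /b; ring.
  have h1 : alpha * b <= b by rewrite ler_piMl // rate_le1.
  have h2 : 4 * b * (1 / 2) <= 4 * b * (1 - (a + b)).
    have b4 : 0 <= 4 * b by lra.
    by rewrite ler_wpM2l //; lra.
  have h3 : (alpha + 4 * b) * (1 - (a + b)) =
      alpha * (1 - a) - alpha * b + 4 * b * (1 - (a + b)) by ring.
  rewrite h3 alphaE; lra.
(* Global uniqueness needs [z] strictly inside the ball. *)
have zlt : enorm (z - zs) < r.
  apply: le_lt_trans ze_lt _; apply: le_lt_trans (er).
  rewrite ler_piMl //; apply: le_trans (ltW rate1).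
  by rewrite lerD2l ler_wpM2l ?c1_ge0 // ltW.
have KzH : sub_KKT c g Omega (lsubmx zj) H z.
  exact/(sub_KKT_linearized_GE c g Omega zs).
exists z; split => //.
- by split => //; exact: sub_KKT_solution KzH.
- apply: (sub_KKT_unique (zs := zs) (r := r)) => // w wr Kw.
  by apply: zu => //; apply/sub_KKT_linearized_GE.
Qed.

End LocalAnalysis.

Theorem corollary4p2 (R : realType) (n m : nat)
    (c : 'rV[R]_n) (g : 'rV[R]_n -> 'rV[R]_m) (Omega : set 'rV[R]_n)
    (Omega_neq0 : Omega !=set0) (Omega_closed : closed Omega)
    (Omega_convex : convex_set Omega)
    (g_diff2 : twice_differentiable g)
    (zs : 'rV[R]_(n + m)) (zs_KKT : is_KKT c g Omega zs)
    (gamma : R) (zs_sreg : strongly_regular c g Omega zs gamma)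
    (kappa : R) (kappa_bnd : 0 <= kappa < (2 * gamma)^-1)
    (omega : R) (omega_ge0 : 0 <= omega)
    (F_lip : \forall z \near zs,
       opnorm ('J (Fmap c g) z - 'J (Fmap c g) zs) <= omega * enorm (z - zs)) :
  exists rz alpha c1 : R,
    [/\ 0 < rz, 0 <= alpha < 1, 0 <= c1,
        (forall (H : nat -> 'M[R]_n) (z0 : 'rV[R]_(n + m)),
           (forall j, psd (H j)) ->
           (forall j, opnorm (hessian_lagrangian g zs - H j) <= kappa) ->
           Omega (lsubmx z0) -> eball zs rz z0 ->
           slater_along c g Omega H z0 ->
           (exists z, scp_run c g Omega H z0 z) /\
           (forall z, scp_run c g Omega H z0 z ->
              [/\ forall j, enorm (z j.+1 - zs)
                    <= (alpha + c1 * enorm (z j - zs)) * enorm (z j - zs),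
                  forall j, sub_KKT c g Omega (lsubmx (z j)) (H j) = [set z j.+1]
                & converges_linearly z zs]))
      & forall z, eball zs rz z -> is_KKT c g Omega z -> z = zs].
Proof.
case: zs_sreg => gamma0 [rdelta [rs [s [rdelta0 rs0 s_single s_lip]]]].
have /andP[kappa0 kappa_lt] := kappa_bnd.
have [rF rF0 rFP] := near_eball F_lip.
set a := gamma * kappa.
(* This is kappa < 1 / (2 gamma), and it makes alpha = a / (1 - a) less than 1. *)
have a_lt : a < 1 / 2.
  move: kappa_lt; rewrite -[(2 * gamma)^-1]mul1r ltr_pdivlMr ?mulr_gt0 //.
  by rewrite /a; lra.
have a0 : 0 <= a by rewrite mulr_ge0 // ltW.
set alpha := a / (1 - a); set c1 := 12 * (gamma * omega).
have alpha0 : 0 <= alpha by rewrite divr_ge0 //; lra.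
have alpha1 : alpha < 1 by rewrite ltr_pdivrMr; lra.
have c10 : 0 <= c1 by rewrite !mulr_ge0 // ltW.
have [r [r0 rrs rrF [rdlt rhalf rrate]]] : exists r, [/\ 0 < r, r < rs, r < rF &
  [/\ r * (2 * (kappa + 3 * (omega * r))) < rdelta,
   gamma * (kappa + 3 * (omega * r)) <= 1 / 2 & alpha + c1 * r < 1]].
  near (0 : R)^'+ => r; exists r.
  have r0 : 0 < r by near: r; exact: nbhs_right_gt.
  have r1 : r < 1 by near: r; exact: nbhs_right_lt.
  have h1 : r * (2 * (kappa + 3 * omega)) < rdelta.
    by near: r; apply: near0_mul_lt => //; rewrite !(mulr_ge0, addr_ge0).
  have h2 : r * (3 * (gamma * omega)) < 1 / 2 - a.
    by near: r; apply: near0_mul_lt; rewrite ?subr_gt0 // !mulr_ge0 // ltW.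
  have h3 : r * c1 < 1 - alpha.
    by near: r; apply: near0_mul_lt => //; rewrite subr_gt0.
  (* As r < 1, the condition quadratic in [r] follows from the linear [h1]. *)
  have or : omega * r <= omega by rewrite ler_piMr // ltW.
  split; [by []|by near: r; exact: nbhs_right_lt|by near: r; exact: nbhs_right_lt|].
  split; last by rewrite mulrC; lra.
    by apply: le_lt_trans h1; rewrite ler_pM2l //; lra.
  by rewrite mulrDr -/a; lra.
have rF_lip z : enorm (z - zs) < r ->
    opnorm ('J (Fmap c g) z - 'J (Fmap c g) zs) <= omega * enorm (z - zs).
  by move=> zr; apply: rFP; exact: lt_trans rrF.
exists r, alpha, c1; split => //; first by rewrite alpha0.
- move=> H z0 Hpsd Hk _ z0r _.
  have step zj j : enorm (zj - zs) < r -> exists z,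
      [/\ scp_step c g Omega zj (H j) z,
      sub_KKT c g Omega (lsubmx zj) (H j) = [set z] &
      enorm (z - zs) <= (alpha + c1 * enorm (zj - zs)) * enorm (zj - zs)].
    move=> zjr; exact: (scp_step_unique Omega_convex g_diff2 zs_KKT gamma0
      rdelta0 rs0 s_single s_lip kappa0 omega_ge0 r0 rrs rF_lip rdlt rhalf
      (Hpsd j) (Hk j) zjr rrate).
  (* The worst rate over the ball, below 1 by the choice of [r]. *)
  set rho := alpha + c1 * r.
  have rho0 : 0 <= rho by rewrite addr_ge0 // mulr_ge0 // ltW.
  have rho_step e : 0 <= e < r -> (alpha + c1 * e) * e <= rho * e.
    by move=> /andP[e0 er]; rewrite ler_wpM2r // lerD2l ler_wpM2l // ltW.
  have rho_lt e : 0 <= e < r -> rho * e < r.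
    by move=> /andP[e0 er]; apply: le_lt_trans er; rewrite ler_piMl // ltW.
  split.
    (* Choice is applied to pairs of an index and a point because the step depends on [H j]. Outside
       the ball the value 0 is a dummy. *)
    have stepr (p : nat * 'rV[R]_(n + m)) : exists q, enorm (p.2 - zs) < r ->
        scp_step c g Omega p.2 (H p.1) q /\ enorm (q - zs) < r.
      case: p => j zj /=.
      have [zjr|_] := boolP (enorm (zj - zs) < r); last by exists 0.
      have [z [z1 _ z2]] := step zj j zjr; exists z => _; split => //.
      have e := rho_lt (enorm (zj - zs)); have e' := rho_step (enorm (zj - zs)).
      rewrite zjr enorm_ge0 in e e'.
      exact: le_lt_trans z2 (le_lt_trans (e' _) (e _)).
    have [f fP] := choice stepr.
    pose z := fix z j := if j is k.+1 then f (k, z k) else z0.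
    have zr j : enorm (z j - zs) < r by elim: j => [|j IH] //; case: (fP (j, z j) IH).
    by exists z; split => // j; case: (fP (j, z j) (zr j)).
  move=> z [zE zstep].
  have run j : enorm (z j - zs) < r -> [/\
      enorm (z j.+1 - zs) <= (alpha + c1 * enorm (z j - zs)) * enorm (z j - zs),
      sub_KKT c g Omega (lsubmx (z j)) (H j) = [set z j.+1] &
      enorm (z j.+1 - zs) <= rho * enorm (z j - zs)].
    (* An arbitrary run obeys the bound: its next iterate is a KKT point of the subproblem, hence
       the unique one [w]. *)
    move=> zjr; have [w [_ Kw we]] := step (z j) j zjr.
    have : sub_KKT c g Omega (lsubmx (z j)) (H j) (z j.+1) by case: (zstep j).
    rewrite Kw => ->; split => //; rewrite (le_trans we) //.
    by apply: rho_step; rewrite enorm_ge0.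
  have zr j : enorm (z j - zs) < r.
    elim: j => [|j IH]; first by rewrite zE.
    have [_ _ h] := run j IH; apply: le_lt_trans h _.
    by apply: rho_lt; rewrite enorm_ge0.
  split => [j|j|]; [by case: (run j (zr j))|by case: (run j (zr j))|].
  split; last by exists rho => [|j]; [rewrite rho0|case: (run j (zr j))].
  apply: cvg_enorm.
  have zgeo j : enorm (z j - zs) <= rho ^+ j * r.
    elim: j => [|j IH]; first by rewrite expr0 mul1r ltW.
    have [_ _ h] := run j (zr j); rewrite (le_trans h) // exprS -mulrA.
    by rewrite ler_wpM2l.
  apply: (@squeeze_cvgr _ _ _ _ (fun=> 0) (fun j => rho ^+ j * r)).
  + by near=> j; rewrite enorm_ge0 zgeo.
  + exact: cvg_cst.
  + rewrite -(mul0r r); apply: cvgM; last exact: cvg_cst.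
    by apply: cvg_expr; rewrite ger0_norm.
- move=> z zr Kz.
  exact: (KKT_locally_unique g_diff2 zs_KKT gamma0 rdelta0 rs0 s_single s_lip
    kappa0 omega_ge0 r0 rrs rF_lip rdlt rhalf zr Kz).
Unshelve. all: by end_near.
Qed.
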